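(* Let $0<p\le q<\infty$. There are positive real numbers $C_{p,q}^1$ and $C_{p,q}^2$, depending only on $p$ and $q$ (and possibly different in each of the three statements), such that for every integer $n\ge 2$: (i) $C_{p,q}^1\,n^{1/q}\le \mathbb{E}\,\|\omega\|_q\le C_{p,q}^2\,n^{1/q}$; (ii) $$C_{p,q}^1\cdot\frac{\mathbb{E}\,\|\omega\|_q}{n^{1/p}}\le \sigma_0^{p,q}(\mu_p)=\int_{\Delta_p^n}\|x\|_q\,d\mu_p(x)\le C_{p,q}^2\cdot\frac{\mathbb{E}\,\|\omega\|_q}{n^{1/p}};$$ (iii) $C_{p,q}^1\,n^{1/q-1/p}\le \sigma_0^{p,q}(\mu_p)\le C_{p,q}^2\,n^{1/q-1/p}$.
   Context: $\omega=(\omega_1,\dots,\omega_n)$ is a vector of independent random variables on $\mathbb{R}_+=[0,\infty)$, each with density $c_pe^{-t^p}$, $t\ge0$, with respect to Lebesgue measure, where $c_p=1/\Gamma(1/p+1)$; $\mathbb{E}$ denotes expectation with respect to $\omega$. For $x\in\mathbb{R}^n$, $\|x\|_q=(\sum_j|x_j|^q)^{1/q}$. Let $\Delta_p^n=\{t\in\mathbb{R}_+^n:\sum_{j=1}^n t_j^p=1\}$. With $I\cdot A=\{tx:t\in I,x\in A\}$ and $\lambda$ the Lebesgue measure on $\mathbb{R}^n$, the normalized cone measure $\mu_p$ on $\Delta_p^n$ is $$\mu_p(\mathcal{A})=\frac{\lambda([0,1]\cdot\mathcal{A})}{\lambda([0,1]\cdot\Delta_p^n)},\quad \mathcal{A}\subset\Delta_p^n.$$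 The best $m$-term approximation error is $\sigma_m(x)_q=\inf\{\|x-y\|_q: y\in\mathbb{R}^n\text{ has at most }m\text{ nonzero coordinates}\}$, and for a Borel probability measure $\mu$ on $\Delta_p^n$ one sets $\sigma_m^{p,q}(\mu)=\int_{\Delta_p^n}\sigma_m(x)_q\,d\mu(x)$. *)

(* Defs.v *)
From HB Require Import structures.
From mathcomp Require Import all_boot all_order all_algebra.
From mathcomp Require Import all_classical all_reals all_analysis.

Set Implicit Arguments.
Unset Strict Implicit.
Unset Printing Implicit Defensive.

Import Order.TTheory GRing.Theory Num.Theory.
Import numFieldNormedType.Exports.

Local Open Scope classical_set_scope.
Local Open Scope ring_scope.

(* Vectors of R^n are represented by [n.-tuple R], whose canonical sigma-algebra
   is the one generated by the coordinates, i.e. the Borel sigma-algebra. *)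

Section vectors.
Context {R : realType} {n : nat}.
Implicit Types (x y : n.-tuple R) (I : set R) (A : set (n.-tuple R)).

Definition tscale (t : R) x : n.-tuple R := [tuple t * tnth x i | i < n].

Definition tsub x y : n.-tuple R := [tuple tnth x i - tnth y i | i < n].

Definition cone I A : set (n.-tuple R) :=
  [set tscale t x | t in I & x in A].

Definition lqnorm (q : R) x : R := (\sum_(i < n) `|tnth x i| `^ q) `^ q^-1.

Definition lp_simplex (p : R) : set (n.-tuple R) :=
  [set t | (forall i, 0 <= tnth t i) /\ \sum_(i < n) tnth t i `^ p = 1].

Definition sparse (m : nat) : set (n.-tuple R) :=
  [set y | (#|[pred i | tnth y i != 0%R]| <= m)%N].

Definition best_approx (q : R) (m : nat) x : R :=
  inf [set lqnorm q (tsub x y) | y in sparse m].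

End vectors.

(* sigma_m^{p,q}(mu) *)
Definition average_best_approx (R : realType) (n : nat) (p q : R) (m : nat)
    (mu : probability (n.-tuple R) R) : \bar R :=
  (\int[mu]_(x in lp_simplex p) (best_approx q m x)%:E)%E.

Section lebesgue_tuple_step.
Context {R : realType} {n : nat}.
Variable m : {sigma_finite_measure set (n.-tuple R) -> \bar R}.
Local Open Scope ereal_scope.

Let tcons (z : measurableTypeR R * n.-tuple R) : n.+1.-tuple R :=
  [the n.+1.-tuple R of z.1 :: z.2].

Let measurable_tcons : measurable_fun setT tcons.
Proof. by apply: measurable_cons; [exact: measurable_fst|exact: measurable_snd].
Qed.

Definition lebesgue_tuple_step : set (n.+1.-tuple R) -> \bar R :=
  pushforward (@lebesgue_measure R \x m) tcons.

Let step0 : lebesgue_tuple_step set0 = 0.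
Proof. by rewrite /lebesgue_tuple_step /pushforward preimage_set0 measure0. Qed.

Let step_ge0 A : 0 <= lebesgue_tuple_step A.
Proof. exact: measure_ge0. Qed.

Let step_additive : semi_sigma_additive lebesgue_tuple_step.
Proof.
move=> F mF tF mUF; rewrite /lebesgue_tuple_step /pushforward preimage_bigcup.
apply: measure_semi_sigma_additive.
- by move=> k; rewrite -[X in measurable X]setTI; exact: measurable_tcons.
- apply/trivIsetP => /= i j _ _ ij; rewrite -preimage_setI.
  by move/trivIsetP : tF => /(_ _ _ _ _ ij) ->//; rewrite preimage_set0.
- by rewrite -preimage_bigcup -[X in measurable X]setTI; exact: measurable_tcons.
Qed.

HB.instance Definition _ := isMeasure.Build _ _ _
  lebesgue_tuple_step step0 step_ge0 step_additive.

Let tuncons (x : n.+1.-tuple R) : measurableTypeR R * n.-tuple R :=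
  (thead x, [tuple of behead x]).

Let measurable_tuncons : measurable_fun setT tuncons.
Proof.
apply: measurable_fun_pair; last exact: measurable_behead.
exact: measurable_tnth.
Qed.

Let tconsK : cancel tcons tuncons.
Proof.
by move=> [a x]; rewrite /tuncons /tcons/= theadE; congr pair; exact: val_inj.
Qed.

Let step_sigma_finite : sigma_finite setT lebesgue_tuple_step.
Proof.
have /sigma_finiteP[F [TF ndF Foo]] := sigma_finiteT (@lebesgue_measure R).
have /sigma_finiteP[G [TG ndG Goo]] := sigma_finiteT m.
exists (fun k => tuncons @^-1` (F k `*` G k)).
  apply/esym; rewrite -subTset => x _; set z := tuncons x.
  have [i _ Fi] : (\bigcup_k F k) z.1 by rewrite -TF.
  have [j _ Gj] : (\bigcup_k G k) z.2 by rewrite -TG.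
  exists (maxn i j) => //; split.
    by apply: subsetPset Fi; apply/ndF/leq_maxl.
  by apply: subsetPset Gj; apply/ndG/leq_maxr.
move=> k; have [mF Fk] := Foo k; have [mG Gk] := Goo k; split.
  rewrite -[X in measurable X]setTI; apply: measurable_tuncons => //.
  exact: measurableX.
rewrite /lebesgue_tuple_step /pushforward -comp_preimage.
rewrite (_ : _ \o _ = id); last by apply/funext => z /=; exact: tconsK.
by rewrite [X in X < _]product_measure1E// lte_mul_pinfty// ge0_fin_numE.
Qed.

HB.instance Definition _ := Measure_isSigmaFinite.Build _ _ _
  lebesgue_tuple_step step_sigma_finite.

End lebesgue_tuple_step.

(* n-dimensional Lebesgue measure on Borel sets, as an iterated product *)
Fixpoint lebesgue_tuple (R : realType) (n : nat) :
    {sigma_finite_measure set (n.-tuple R) -> \bar R} :=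
  match n with
  | 0 => \d_([tuple] : 0.-tuple R)
  | n'.+1 => lebesgue_tuple_step (lebesgue_tuple R n')
  end.

Definition box (R : realType) n (a : R) : set (n.-tuple R) :=
  [set x | forall i, 0 <= tnth x i <= a].
Arguments box {R} n a.

Section lebesgue_tuple_box.
Context {R : realType}.
Local Open Scope ereal_scope.

Lemma measurable_box n (a : R) : measurable (box n a).
Proof.
rewrite (_ : box n a =
    \bigcap_(i in [set: 'I_n]) ((@tnth n R ^~ i) @^-1` `[0%R, a])); last first.
  apply/seteqP; split=> x /= xa i; first by move=> _; rewrite /= in_itv/=.
  by have := xa i I; rewrite /= in_itv.
apply: fin_bigcap_measurable => // i _.
by rewrite -[X in measurable X]setTI; exact: measurable_tnth.
Qed.

Lemma lebesgue_tuple_box n (a : R) : (0 <= a)%R ->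
  lebesgue_tuple R n (box n a) = (a ^+ n)%:E.
Proof.
move=> a0; elim: n => [|n ih].
  rewrite /= /dirac/= indicE mem_set//.
  by move=> -[].
rewrite /= /lebesgue_tuple_step /pushforward.
rewrite (_ : _ @^-1` _ = `[0%R, a]%classic `*` box n a); last first.
  apply/seteqP; split=> [[t x] /= tx|[t x] [/= ta xa] i].
    split; first by have := tx ord0; rewrite /= in_itv.
    by move=> i; have := tx (lift ord0 i); rewrite tnthS.
  case: (unliftP ord0 i) => [j|] ->; first by rewrite tnthS.
  by move: ta; rewrite in_itv.
rewrite product_measure1E//; last exact: measurable_box.
rewrite [X in _ * X]ih [X in X * _](lebesgue_measure_itv `[0%R, a])/= lte_fin.
case: ltP => a0'.
  by rewrite oppr0 adde0 -EFinM exprS.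
have -> : a = 0%R by apply/eqP; rewrite eq_le a0 a0'.
by rewrite mul0e exprS mul0r.
Qed.

End lebesgue_tuple_box.

(* Normalized cone measure, seen as a Borel measure on R^n carried by the simplex.
   Both proofs are needed for it to be a probability: for p = 0 the simplex is
   not transverse to rays, and in dimension 0 it is empty. *)
Definition cone_measure (R : realType) (p : R) (n : nat)
    (p0 : 0 < p) (n0 : (0 < n)%N) : set (n.-tuple R) -> \bar R :=
  fun A => (lebesgue_tuple R n (cone `[0%R, 1%R] (A `&` lp_simplex p)) /
            lebesgue_tuple R n (cone `[0%R, 1%R] (lp_simplex p)))%E.

Section cone_measure_probability.
Context {R : realType} {p : R} {n : nat}.
Hypotheses (p0 : 0 < p) (n0 : (0 < n)%N).

Let lam := lebesgue_tuple R n.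
Let S (x : n.-tuple R) : R := \sum_(i < n) tnth x i `^ p.
Let D : set (n.-tuple R) :=
  [set x | forall i, 0 <= tnth x i] `&` [set x | 0 < S x <= 1].
Let g (x : n.-tuple R) : n.-tuple R := tscale (S x `^ (- p^-1)) x.
Let coneD A := cone `[0, 1] (A `&` @lp_simplex R n p).

Let p_neq0 : p != 0. Proof. by rewrite gt_eqF. Qed.

Let le1_powR (a e : R) : 0 < e -> 0 <= a -> a <= 1 -> a `^ e <= 1.
Proof.
move=> e0 a0 a1; have -> : 1 = 1 `^ e :> R by rewrite powR1.
by apply: ge0_ler_powR => //; rewrite ?nnegrE ?ltW.
Qed.

Let S_tscale t x : 0 <= t -> (forall i, 0 <= tnth x i) ->
  S (tscale t x) = t `^ p * S x.
Proof.
move=> t0 x0; rewrite /S mulr_sumr; apply: eq_bigr => i _.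
by rewrite tnth_mktuple powRM.
Qed.

Let tscaleA s t (x : n.-tuple R) : tscale s (tscale t x) = tscale (s * t) x.
Proof. by apply: eq_from_tnth => i; rewrite !tnth_mktuple mulrA. Qed.

Let tscale1 (x : n.-tuple R) : tscale 1 x = x.
Proof. by apply: eq_from_tnth => i; rewrite tnth_mktuple mul1r. Qed.

Let sub_coneD A : D `&` g @^-1` A `<=` coneD A.
Proof.
move=> x [[x0 /andP[Sx0 Sx1]] gxA]; have Sxn : S x != 0 by rewrite gt_eqF.
exists (S x `^ p^-1).
  rewrite /= in_itv/= powR_ge0/=.
  by apply: le1_powR (ltW Sx0) Sx1; rewrite invr_gt0.
exists (g x).
  split => //; split=> [i|]; first by rewrite tnth_mktuple mulr_ge0 ?powR_ge0.
  rewrite -/(S (g x)) S_tscale ?powR_ge0// -powRrM mulNr mulVf//.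
  by rewrite powR_inv1 ?mulVf// ltW.
rewrite tscaleA -powRD; last by rewrite Sxn implybT.
by rewrite subrr powRr0 tscale1.
Qed.

Let coneD_sub A : coneD A `<=` (D `&` g @^-1` A) `|` box n 0.
Proof.
move=> _ [t /= + [y [Ay [y0 Sy]] <-]]; rewrite in_itv/= => /andP[t0 t1].
have Sty : S (tscale t y) = t `^ p by rewrite S_tscale// /S Sy mulr1.
move: t0; rewrite le_eqVlt => /orP[/eqP <-|t0].
  by right => i; rewrite tnth_mktuple mul0r lexx.
left; split; first split.
- by move=> i; rewrite tnth_mktuple mulr_ge0// ltW.
- rewrite /= Sty powR_gt0//=.
  exact: le1_powR p0 (ltW t0) t1.
- rewrite /preimage/= /g tscaleA Sty -powRrM mulrN mulfV//.
  by rewrite powR_inv1 ?ltW// mulVf ?gt_eqF// tscale1.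
Qed.

Let measurable_S : measurable_fun setT S.
Proof.
apply: measurable_sum => i.
apply: (@measurableT_comp _ _ _ _ _ _ (@powR R ^~ p)) => //.
exact: measurable_tnth.
Qed.

Let measurable_g : measurable_fun setT g.
Proof.
apply/measurable_fun_tnthP => i.
rewrite (_ : _ \o _ = fun x => S x `^ (- p^-1) * tnth x i); last first.
  by apply/funext => x /=; rewrite tnth_mktuple.
apply: measurable_realfun.measurable_funM; last exact: measurable_tnth.
exact: (@measurableT_comp _ _ _ _ _ _ (@powR R ^~ (- p^-1))).
Qed.

Let measurable_D : measurable D.
Proof.
apply: measurableI.
  rewrite (_ : mkset _ =
      \bigcap_(i in [set: 'I_n]) ((@tnth n R ^~ i) @^-1` `[0, +oo[)).
    apply: fin_bigcap_measurable => // i _.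
    by rewrite -[X in measurable X]setTI; exact: measurable_tnth.
  apply/seteqP; split=> x /= xa i; first by move=> _; rewrite /= in_itv/= xa.
  by have := xa i I; rewrite /= in_itv/= andbT.
rewrite (_ : mkset _ = S @^-1` `]0, 1]); last first.
  by apply/seteqP; split=> x /=; rewrite in_itv.
by rewrite -[X in measurable X]setTI; exact: measurable_S.
Qed.

Let measurable_Dg A : measurable A -> measurable (D `&` g @^-1` A).
Proof.
move=> mA; apply: measurableI => //.
by rewrite -[X in measurable X]setTI; exact: measurable_g.
Qed.

Let measurable_coneD A : measurable A -> measurable (coneD A).
Proof.
move=> mA; have [A0|/set0P[y ADy]] := eqVneq (A `&` @lp_simplex R n p) set0.
  rewrite (_ : coneD A = set0)//; apply/seteqP; split=> // x [t _].
  by rewrite A0 => -[].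
rewrite (_ : coneD A = (D `&` g @^-1` A) `|` box n 0).
  by apply: measurableU; [exact: measurable_Dg|exact: measurable_box].
apply/seteqP; split; first exact: coneD_sub.
move=> x [|x0]; first exact: sub_coneD.
exists 0; first by rewrite /= in_itv/= lexx ler01.
exists y => //; apply: eq_from_tnth => i; rewrite tnth_mktuple mul0r.
by apply/esym/eqP; rewrite eq_le andbC.
Qed.

Let lam_box0 : lam (box n 0) = 0%E.
Proof. by rewrite [LHS]lebesgue_tuple_box// expr0n gtn_eqF. Qed.

Let lam_coneD A : measurable A -> lam (coneD A) = lam (D `&` g @^-1` A).
Proof.
move=> mA; apply/eqP; rewrite eq_le; apply/andP; split; last first.
  apply: le_measure; rewrite ?inE; [exact: measurable_Dg|
    exact: measurable_coneD|exact: sub_coneD].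
apply: (@le_trans _ _ (lam ((D `&` g @^-1` A) `|` box n 0))).
  apply: le_measure; rewrite ?inE; [exact: measurable_coneD| |exact: coneD_sub].
  by apply: measurableU; [exact: measurable_Dg|exact: measurable_box].
apply: (le_trans (measureU2 _ _ _)) => //.
- exact: measurable_Dg.
- exact: measurable_box.
- by rewrite [X in (_ + X)%E]lam_box0 adde0.
Qed.

Let coneDT : coneD setT = cone `[0, 1] (lp_simplex p).
Proof. by rewrite /coneD setTI. Qed.

Lemma lebesgue_cone_lp_simplex_gt0 :
  (0 < lebesgue_tuple R n (cone `[0%R, 1%R] (lp_simplex p)))%E.
Proof.
rewrite -coneDT lam_coneD// preimage_setT setIT.
set b : R := n%:R^-1 `^ p^-1.
have nR : 0 < n%:R :> R by rewrite ltr0n.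
have b0 : 0 < b by rewrite powR_gt0// invr_gt0.
apply: (@lt_le_trans _ _ (lam (box n b))).
  by rewrite [ltRHS]lebesgue_tuple_box ?ltW// lte_fin exprn_gt0.
apply: (@le_trans _ _ (lam (D `|` box n 0))).
  apply: le_measure; rewrite ?inE; [exact: measurable_box| |].
    by apply: measurableU => //; exact: measurable_box.
  move=> x xb; have [S0|Sn0] := eqVneq (S x) 0.
    right => i.
    have := psumr_eq0P (fun i _ => powR_ge0 (tnth x i) p) S0 => /(_ i isT).
    by move=> /powR_eq0_eq0 ->; rewrite lexx.
  left; split; first by move=> i; have /andP[] := xb i.
  rewrite /= lt_neqAle eq_sym Sn0/= sumr_ge0/=; last by move=> i _; exact: powR_ge0.
  rewrite (_ : 1 = \sum_(i < n) (n%:R^-1 : R)); last first.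
    by rewrite sumr_const card_ord -[RHS]mulr_natr mulVf// gt_eqF.
  apply: ler_sum => i _; have /andP[xi0 xib] := xb i.
  rewrite (_ : n%:R^-1 = b `^ p).
    by apply: ge0_ler_powR => //; rewrite ?nnegrE ?ltW.
  by rewrite /b -powRrM mulVf// powRr1// invr_ge0 ltW.
apply: (le_trans (measureU2 _ _ _)) => //; first exact: measurable_box.
by rewrite [X in (_ + X)%E]lam_box0 adde0.
Qed.

Lemma lebesgue_cone_lp_simplex_lty :
  (lebesgue_tuple R n (cone `[0%R, 1%R] (lp_simplex p)) < +oo)%E.
Proof.
rewrite -coneDT; apply: (@le_lt_trans _ _ (lam (box n 1))); last first.
  by rewrite [ltLHS]lebesgue_tuple_box// ltry.
apply: le_measure; rewrite ?inE; [exact: measurable_coneD|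
  exact: measurable_box|].
move=> _ [t /= + [y [_ [y0 Sy]] <-] i]; rewrite in_itv/= => /andP[t0 t1].
rewrite tnth_mktuple mulr_ge0//= mulr_ile1//.
rewrite leNgt; apply/negP => y1.
have : tnth y i `^ p <= 1.
  rewrite -Sy (bigD1 i)//= lerDl; apply: sumr_ge0 => j _; exact: powR_ge0.
apply/negP; rewrite -ltNge.
by have := @gt0_ltr_powR _ p p0 1 (tnth y i); rewrite powR1; apply;
  rewrite ?nnegrE.
Qed.

Let c : R := fine (lebesgue_tuple R n (cone `[0, 1] (lp_simplex p))).

Let cE : lebesgue_tuple R n (cone `[0%R, 1%R] (lp_simplex p)) = c%:E.
Proof.
by rewrite fineK// gt0_fin_numE ?lebesgue_cone_lp_simplex_gt0//
  lebesgue_cone_lp_simplex_lty.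
Qed.

Let c_gt0 : 0 < c.
Proof. by rewrite -lte_fin -cE; exact: lebesgue_cone_lp_simplex_gt0. Qed.

Let cV_ge0 : 0 <= c^-1. Proof. by rewrite invr_ge0 ltW. Qed.

Let cone_measureE A : measurable A ->
  cone_measure p0 n0 A = mscale (NngNum cV_ge0) lam (D `&` g @^-1` A).
Proof.
move=> mA; rewrite /cone_measure cE inver gt_eqF// -/(coneD A).
by rewrite [X in (X * _)%E](lam_coneD mA) muleC.
Qed.

Let cone_measure0 : cone_measure p0 n0 set0 = 0%E.
Proof. by rewrite cone_measureE// preimage_set0 setI0 measure0. Qed.

Let cone_measure_ge0 A : (0 <= cone_measure p0 n0 A)%E.
Proof.
by rewrite /cone_measure cE inver gt_eqF// mule_ge0 ?measure_ge0// lee_fin.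
Qed.

Let cone_measure_additive : semi_sigma_additive (cone_measure p0 n0).
Proof.
move=> F mF tF mUF; rewrite cone_measureE// preimage_bigcup setI_bigcupr.
rewrite (_ : (fun _ => _) = fun k =>
    (\sum_(0 <= i < k) mscale (NngNum cV_ge0) lam (D `&` g @^-1` F i))%E).
  apply: measure_semi_sigma_additive.
  - by move=> i; exact: measurable_Dg.
  - apply/trivIsetP => /= i j _ _ ij; rewrite setIACA setIid -preimage_setI.
    by move/trivIsetP : tF => /(_ _ _ _ _ ij) ->//; rewrite preimage_set0 setI0.
  - by rewrite -setI_bigcupr -preimage_bigcup; exact: measurable_Dg.
by apply/funext => k; apply: eq_bigr => i _; rewrite cone_measureE.
Qed.

HB.instance Definition _ := isMeasure.Build _ _ _ (cone_measure p0 n0)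
  cone_measure0 cone_measure_ge0 cone_measure_additive.

Let cone_measure_setT : cone_measure p0 n0 setT = 1%E.
Proof.
by rewrite /cone_measure setTI cE inver gt_eqF// -EFinM mulfV// gt_eqF.
Qed.

HB.instance Definition _ := Measure_isProbability.Build _ _ R
  (cone_measure p0 n0) cone_measure_setT.

End cone_measure_probability.

Definition Gamma (R : realType) (x : R) : R :=
  \int[@lebesgue_measure R]_(t in `]0, +oo[) (t `^ (x - 1) * expR (- t)).

(* c_p e^{-t^p} 1_{t >= 0}, with c_p = 1 / Gamma(1/p + 1) *)
Definition gen_normal_pdf (R : realType) (p t : R) : R :=
  if 0 <= t then (Gamma (p^-1 + 1))^-1 * expR (- t `^ p) else 0.

Definition has_density d (Omega : measurableType d) (R : realType)
    (P : probability Omega R) (X : {RV P >-> R}) (f : R -> R) : Prop :=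
  forall A : set R, measurable A ->
    distribution P X A = (\int[@lebesgue_measure R]_(t in A) (f t)%:E)%E.

Definition mutually_independent d (Omega : measurableType d) (R : realType)
    (P : probability Omega R) (I : finType) (X : I -> {RV P >-> R}) : Prop :=
  forall (J : {set I}) (A : I -> set R), (forall i, measurable (A i)) ->
    P (\bigcap_(i in [set` J]) (X i @^-1` A i)) =
    (\prod_(i in J) P (X i @^-1` A i))%E.

(* E ||omega||_q *)
Definition expected_norm d (Omega : measurableType d) (R : realType)
    (P : probability Omega R) (n : nat) (omega : 'I_n -> {RV P >-> R}) (q : R)
    : \bar R :=
  ('E_P[fun w => lqnorm q [tuple omega i w | i < n]])%E.

(* Main.v *)
(** Both the law of omega and the cone measure have the tail bound
    [P (Y_i >= u) <= K exp (- a u^p)], the latter for [Y = n^(1/p) x]; each is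
    obtained by a linear change of variables alone. For omega, the substitution
    [t -> 2^(-1/p) t] turns [exp (- t^p / 2)] back into the density. For the
    cone measure, shrinking the i-th coordinate by [2^(-1/p)] replaces
    [sum_j x_j^p] by [sum_j x_j^p - x_i^p / 2], so that the cone over
    [{n x_i^p >= u^p}] stays in the unit ball after a further dilation by
    [(1 - u^p / (2 n))^(-1/p)]; comparing volumes gives the bound.
    Such tails bound all moments uniformly, and
    [||y||_q <= n^(1/q) (1 + mean y^r)] with [r = max q 1] gives the upper
    estimates. The lower estimate for the cone measure is the power mean
    inequality, which is where [p <= q] enters; for omega it holds because the
    density is bounded, so each coordinate exceeds a fixed threshold with
    probability at least 1/2. Part (ii) is the quotient of the other two. *)

Require Import Defs.
From HB Require Import structures.
From mathcomp Require Import all_boot all_order all_algebra.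
From mathcomp Require Import all_classical all_reals all_analysis.
From mathcomp Require Import measurable_realfun ring lra.

Set Implicit Arguments.
Unset Strict Implicit.
Unset Printing Implicit Defensive.

Import Order.TTheory GRing.Theory Num.Theory.
Import numFieldNormedType.Exports.

Local Open Scope classical_set_scope.
Local Open Scope ring_scope.

(** * Bernoulli's inequality for real exponents and the power mean inequality *)

Section power_means.
Context {R : realType}.
Implicit Types p q e x y : R.

(** The case [e > 1] is Young's inequality for the product [x * 1], with exponent [e] and its
    conjugate [(1 - e^-1)^-1], multiplied by [e]. *)
Lemma bernoulli_powR e x : 1 <= e -> 0 <= x -> 1 + e * (x - 1) <= x `^ e.
Proof.
rewrite le_eqVlt => /predU1P[<- x0|e1 x0].
  by rewrite powRr1// mul1r addrC subrK.
have e0 : 0 < e by rewrite (lt_trans _ e1).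
have d0 : 0 < 1 - e^-1 by rewrite subr_gt0 invf_lt1.
have := @conjugate_powR R x 1 e (1 - e^-1)^-1 x0 ler01 e0.
rewrite invr_gt0 d0 invrK addrC subrK mulr1 powR1 mul1r => /(_ isT erefl) xe.
rewrite -(ler_pM2l (_ : 0 < e^-1)) ?invr_gt0//.
rewrite mulrDr mulrA mulVf ?gt_eqF// mul1r mulr1 addrCA.
by rewrite -lerBrDr opprB mulrC.
Qed.

(** This is Jensen's inequality for the exponent [q / p]. With [s] the mean of the [z i ^ p],
    Bernoulli's inequality is applied to each [z i ^ p / s]; these quotients have mean 1, so the
    linear terms cancel in the sum. For [n = 0] both sides are 0. *)
Lemma power_mean n (z : 'I_n -> R) p q : 0 < p -> p <= q -> (forall i, 0 <= z i) ->
  (n%:R^-1 * \sum_(i < n) z i `^ p) `^ p^-1 <=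
  (n%:R^-1 * \sum_(i < n) z i `^ q) `^ q^-1.
Proof.
move=> p0 pq z0; have q0 : 0 < q by exact: lt_le_trans pq.
case: n z z0 => [|n] z z0; first by rewrite !big_ord0 !mulr0 !powR0// invr_eq0 gt_eqF.
set s := _ * _; set t := (X in _ <= X `^ _).
have n0 : 0 < n.+1%:R :> R by [].
have s0 : 0 <= s.
  by rewrite mulr_ge0 ?invr_ge0// ?sumr_ge0// => i _; exact: powR_ge0.
have t0 : 0 <= t.
  by rewrite mulr_ge0 ?invr_ge0// ?sumr_ge0// => i _; exact: powR_ge0.
suff : s `^ (q / p) <= t.
  move=> st; have := ge0_ler_powR (_ : 0 <= q^-1) (powR_ge0 _ _ : _ \in Num.nneg) t0 st.
  by rewrite -powRrM mulrAC mulfV ?gt_eqF// mul1r; apply; rewrite invr_ge0 ltW.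
move: s0; rewrite le_eqVlt => /predU1P[<-|s0].
  by rewrite powR0// mulf_neq0 ?invr_eq0 ?gt_eqF.
have e1 : 1 <= q / p by rewrite ler_pdivlMr// mul1r.
suff : 1 <= t / s `^ (q / p) by rewrite ler_pdivlMr ?powR_gt0// mul1r.
have -> : 1 = n.+1%:R^-1 * \sum_(i < n.+1) (1 + q / p * (z i `^ p / s - 1)) :> R.
  rewrite big_split/= -mulr_sumr big_split/= sumr_const card_ord sumrN.
  rewrite sumr_const card_ord -mulr_suml.
  suff -> : (\sum_(i < n.+1) z i `^ p) / s = n.+1%:R.
    by rewrite subrr mulr0 addr0 mulVf ?gt_eqF.
  rewrite /s invfM invrK mulrCA mulfV ?mulr1// gt_eqF//.
  by rewrite -(pmulr_rgt0 _ (_ : 0 < n.+1%:R^-1)).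
rewrite /t -mulrA ler_pM2l ?invr_gt0// mulr_suml; apply: ler_sum => i _.
apply: le_trans (bernoulli_powR e1 _) _; first by rewrite divr_ge0 ?powR_ge0// ltW.
rewrite powRM ?powR_ge0 ?invr_ge0 ?(ltW s0)// -powRrM (_ : p * (q / p) = q).
  by rewrite -(powR_inv1 (ltW s0)) -powRrM mulN1r powRN.
by rewrite mulrCA mulfV ?mulr1// gt_eqF.
Qed.

End power_means.

(** * Expectations bounded through dyadic tails *)

Section tail_bounds.
Context {R : realType}.
Local Open Scope ereal_scope.

Lemma le_dyadic_nneseries (z : R) : (0 <= z)%R ->
  z%:E <= 1 + \sum_(0 <= j <oo) (2 ^+ j.+1 * (2 ^+ j <= z)%R%:R)%:E.
Proof.
move=> z0; pose u j : \bar R := (2 ^+ j.+1 * (2 ^+ j <= z)%R%:R)%:E.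
have u0 j : 0 <= u j by rewrite lee_fin mulr_ge0// exprn_ge0.
have [z1|z1] := ltP z 1%R.
  by rewrite -[leLHS]adde0 leeD ?nneseries_ge0// lee_fin ltW.
have /andP[kz zk] := truncn_itv z0; set k := Num.trunc z in kz zk.
have k0 : (0 < k)%N by rewrite lt0n; apply: contraTneq zk => ->; rewrite -leNgt.
(* This [j] satisfies [2 ^ j <= k <= z < k + 1 <= 2 ^ (j + 1)], so the single term of index [j]
   already dominates [z]. *)
set j := trunc_log 2 k.
rewrite -[leLHS]add0e leeD// (le_trans _ (nneseries_lim_ge j.+1 _))//.
rewrite big_nat_recr//= -[leLHS]add0e leeD ?sume_ge0//.
rewrite /u lee_fin (le_trans _ kz) ?mulr1 -natrX ?ler_nat ?trunc_logP//.
by rewrite (le_trans (ltW zk))// ler_nat trunc_log_ltn.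
Qed.

(** Integrating the dyadic bound termwise gives at most [2 ^ (j + 1) * C / 4 ^ j = 4 * C / 2 ^ (j +
    1)] for each [j], a geometric series of sum [4 * C]; the leading 1 contributes at most 1. *)
Lemma dyadic_tail_expectation d (T : measurableType d) (P : probability T R)
    (Z : T -> R) (C : R) : measurable_fun setT Z ->
  (forall x, 0 <= Z x)%R -> (0 <= C)%R ->
  (forall j, P [set x | 2 ^+ j <= Z x]%R <= (C / 4 ^+ j)%:E) ->
  \int[P]_x (Z x)%:E <= (1 + 4 * C)%:E.
Proof.
move=> mZ Z0 C0 PZ; pose A j := [set x | 2 ^+ j <= Z x]%R.
have mA j : measurable (A j).
  by rewrite -[A j]setTI; apply: measurable_fun_le => //; exact: measurable_cst.
pose f j x : \bar R := (2 ^+ j.+1)%:E * (\1_(A j) x)%:E.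
have f0 j x : 0 <= f j x by rewrite /f -EFinM lee_fin mulr_ge0// exprn_ge0.
have mf j : measurable_fun setT (f j).
  by apply: measurable_funeM; apply/measurable_EFinP; exact: measurable_indic.
have msf : measurable_fun setT (fun x => \sum_(0 <= j <oo) f j x).
  exact: ge0_emeasurable_sum.
apply: (@le_trans _ _ (\int[P]_x (1 + \sum_(0 <= j <oo) f j x))).
  apply: ge0_le_integral => //.
  - by move=> x _; rewrite lee_fin.
  - exact/measurable_EFinP.
  - exact: emeasurable_funD.
  - move=> x _; rewrite (le_trans (le_dyadic_nneseries (Z0 x)))// leeD//.
    apply: lee_nneseries => j _; first by rewrite lee_fin mulr_ge0// exprn_ge0.
    rewrite /f -EFinM indicE (_ : (x \in A j) = (2 ^+ j <= Z x)%R)//.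
    by apply/idP/idP => [/set_mem//|h]; exact/mem_set.
rewrite ge0_integralD//; last by move=> x _; exact: nneseries_ge0.
rewrite integral_cst// mul1e EFinD leeD//; first exact: probability_le1.
rewrite integral_nneseries//.
have := @cvg_geometric_eseries_half R (4 * C) 0.
rewrite expr0 divr1 => /cvg_lim <- //; apply: lee_nneseries => [j _ _|j _].
  exact: integral_ge0.
rewrite ge0_integralZl//; last exact/measurable_EFinP/measurable_indic.
rewrite integral_indic// setIT.
apply: le_trans (lee_wpmul2l _ (PZ j)) _; first by rewrite lee_fin exprn_ge0.
rewrite -EFinM lee_fin.
rewrite addn1 natrX ler_pdivlMr ?exprn_gt0// (_ : 4 = 2 * 2)%R; last by ring.
by rewrite exprMn exprS le_eqVlt; apply/orP; left; apply/eqP; field; rewrite expf_neq0.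
Qed.

End tail_bounds.

(** * Upper bound for the mean norm of a vector whose coordinates have stretched exponential
    tails *)

Section lqnorm_bounds.
Context {R : realType}.
Implicit Types p q r : R.

Lemma lqnormE n q (x : n.-tuple R) : (0 < n)%N -> 0 < q ->
  lqnorm q x =
  n%:R `^ q^-1 * (n%:R^-1 * \sum_(i < n) `|tnth x i| `^ q) `^ q^-1.
Proof.
move=> n0 q0; have nR : 0 < n%:R :> R by rewrite ltr0n.
rewrite -powRM ?ler0n//; last first.
  by rewrite mulr_ge0 ?invr_ge0// sumr_ge0// => i _; exact: powR_ge0.
by rewrite mulrA mulfV ?gt_eqF// mul1r.
Qed.

Lemma measurable_lqnorm n q : measurable_fun setT (@lqnorm R n q).
Proof.
apply: (@measurableT_comp _ _ _ _ _ _ (@powR R ^~ q^-1)) => //.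
apply: measurable_sum => i.
apply: (@measurableT_comp _ _ _ _ _ _ (@powR R ^~ q)) => //.
by apply: measurableT_comp => //; exact: measurable_tnth.
Qed.

Lemma lqnorm_ge0 n q (x : n.-tuple R) : 0 <= lqnorm q x.
Proof. exact: powR_ge0. Qed.

(** After passing from exponent [q] to [r], the outer root is removed by [s ^ (1/r) <= 1 + s], valid
    because [r >= 1]. The resulting bound is a sum over coordinates and can be integrated term by
    term. *)
Lemma lqnorm_le n q r (x : n.-tuple R) : (0 < n)%N -> 0 < q -> q <= r -> 1 <= r ->
  lqnorm q x <= n%:R `^ q^-1 * (1 + n%:R^-1 * \sum_(i < n) `|tnth x i| `^ r).
Proof.
move=> n0 q0 qr r1; rewrite lqnormE// ler_wpM2l ?powR_ge0//.
apply: le_trans (power_mean q0 qr _) _ => //.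
set s := _ * _; have s0 : 0 <= s.
  by rewrite mulr_ge0 ?invr_ge0// sumr_ge0// => i _; exact: powR_ge0.
have r0 : 0 < r by exact: lt_le_trans r1.
have [s1|s1] := leP s 1.
  rewrite (@le_trans _ _ 1) ?lerDl//.
  have := @ge0_ler_powR R r^-1 _ s 1; rewrite powR1.
  by apply; rewrite ?nnegrE// invr_ge0 ltW.
rewrite (le_trans (ler1_powR (ltW s1) _)) ?lerDr//.
by rewrite invf_le1.
Qed.

(** A single term of the exponential series gives [(a t)^m / m! <= exp (a t)]. *)
Lemma expRN_mul_exprn (a t : R) (m : nat) : 0 < a -> 0 <= t ->
  expR (- (a * t)) * t ^+ m <= m`!%:R / a ^+ m.
Proof.
move=> a0 t0; have am : 0 < a ^+ m by rewrite exprn_gt0.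
suff atm : (a * t) ^+ m <= m`!%:R * expR (a * t).
  rewrite expRN ler_pdivlMr// -mulrA mulrC ler_pdivrMr ?expR_gt0//.
  by rewrite mulrC -exprMn.
have at0 : 0 <= a * t by rewrite mulr_ge0// ltW.
case: m {am} => [|m]; first by rewrite expr0 fact0 mul1r -[leLHS]expR0 ler_expR.
rewrite [leRHS]mulrC -ler_pdivrMr ?ltr0n ?fact_gt0//.
by rewrite (le_trans _ (expR_ge1Dxn m at0))// lerDr.
Qed.

Local Open Scope ereal_scope.

(** The constant is quantified before the probability space and the variable, which makes the moment
    bound uniform in the dimension and the coordinate. *)
Lemma stretched_tail_moment (p r K a : R) : (0 < p)%R -> (0 < r)%R -> (0 <= K)%R ->
    (0 < a)%R ->
  exists2 C : R, (0 <= C)%R &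
    forall d (T : measurableType d) (P : probability T R) (Y : T -> R),
      measurable_fun setT Y ->
      (forall u : R, (0 < u)%R ->
        P [set x | u <= `|Y x|]%R <= (K * expR (- (a * u `^ p)))%:E) ->
      \int[P]_x (`|Y x| `^ r)%:E <= C%:E.
Proof.
(* With [p * m / r >= 2], the level [u = 2 ^ (j / r)] has [(u ^ p) ^ m >= 4 ^ j], which is the decay
   that the dyadic criterion asks for. *)
move=> p0 r0 K0 a0; pose m := (Num.trunc (2 * r / p)).+1.
have mp : (2 <= p / r * m%:R)%R.
  have rp0 : (0 <= 2 * r / p)%R by rewrite divr_ge0 ?mulr_ge0 ?ltW.
  rewrite mulrAC ler_pdivlMr// [leRHS]mulrC -ler_pdivrMr//.
  by have /andP[_ /ltW] := truncn_itv rp0.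
pose C : R := (K * (m`!%:R / a ^+ m))%R.
have C0 : (0 <= C)%R by rewrite mulr_ge0// divr_ge0// exprn_ge0// ltW.
exists (1 + 4 * C)%R; first by rewrite addr_ge0// mulr_ge0.
move=> d T P Y mY PY; apply: dyadic_tail_expectation => //.
- apply: (@measurableT_comp _ _ _ _ _ _ (@powR R ^~ r)) => //.
  exact: measurableT_comp.
move=> j; pose u : R := ((2 ^+ j) `^ r^-1)%R.
have j0 : (0 < 2 ^+ j :> R)%R by rewrite exprn_gt0.
have u0 : (0 < u)%R by rewrite powR_gt0.
rewrite (_ : [set x | _] = [set x | u <= `|Y x|]%R); last first.
  apply/seteqP; split => x /= h.
    have := @ge0_ler_powR R r^-1%R _ (2 ^+ j)%R (`|Y x| `^ r)%R.
    rewrite -powRrM mulfV ?gt_eqF// powRr1//.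
    by apply; rewrite ?nnegrE ?powR_ge0 ?invr_ge0// ltW.
  have := @ge0_ler_powR R r (ltW r0) u `|Y x|%R.
  rewrite -powRrM mulVf ?gt_eqF// powRr1 ?(ltW j0)//.
  by apply; rewrite ?nnegrE// ltW.
apply: le_trans (PY u u0) _; rewrite lee_fin -mulrA ler_wpM2l//.
rewrite ler_pdivlMr ?exprn_gt0//; apply: le_trans (expRN_mul_exprn m a0 (powR_ge0 u p)).
rewrite ler_wpM2l ?expR_ge0// -powR_mulrn ?powR_ge0// /u -!powRrM.
rewrite (_ : 4 ^+ j = (2 ^+ j) `^ 2)%R; last first.
  by rewrite powR_mulrn ?(ltW j0)// -exprM mulnC exprM; congr (_ ^+ j)%R; ring.
apply: ler_powR; last by rewrite -?mulrA mulrCA mulrA.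
by rewrite exprn_ege1// ler1n.
Qed.

(** Linearity of the integral reduces the bound to the [r]-th moments of the single coordinates,
    with [r = max q 1]. *)
Lemma lqnorm_tail_expectation (p q K a : R) : (0 < p)%R -> (0 < q)%R -> (0 <= K)%R ->
    (0 < a)%R ->
  exists2 C : R, (0 < C)%R &
    forall n (n0 : (0 < n)%N) d (T : measurableType d) (P : probability T R)
      (Y : 'I_n -> T -> R),
      (forall i, measurable_fun setT (Y i)) ->
      (forall i (u : R), (0 < u)%R ->
        P [set x | u <= `|Y i x|]%R <= (K * expR (- (a * u `^ p)))%:E) ->
      \int[P]_x (lqnorm q [tuple Y i x | i < n])%:E <= (C * n%:R `^ q^-1)%:E.
Proof.
move=> p0 q0 K0 a0; pose r := Num.max q 1%R.
have qr : (q <= r)%R by rewrite le_max lexx.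
have r1 : (1 <= r)%R by rewrite le_max lexx orbT.
have r0 : (0 < r)%R by exact: lt_le_trans r1.
have [C C0 CP] := stretched_tail_moment p0 r0 K0 a0.
exists (1 + C)%R; first by rewrite ltr_pwDl.
move=> n n0 d T P Y mY PY.
have mYr i : measurable_fun setT (fun x => `|Y i x| `^ r)%R.
  apply: (@measurableT_comp _ _ _ _ _ _ (@powR R ^~ r)) => //.
  exact: measurableT_comp.
have nV : (0 <= n%:R^-1 :> R)%R by rewrite invr_ge0.
have s0 x : (0 <= n%:R^-1 * \sum_(i < n) `|Y i x| `^ r)%R.
  by rewrite mulr_ge0// sumr_ge0// => i _; exact: powR_ge0.
have ms : measurable_fun setT (fun x => n%:R^-1 * \sum_(i < n) `|Y i x| `^ r)%R.
  by apply: measurable_funM => //; exact: measurable_sum.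
have mg : measurable_fun setT (fun x => 1 + n%:R^-1 * \sum_(i < n) `|Y i x| `^ r)%R.
  exact: measurable_funD.
apply: (@le_trans _ _ (\int[P]_x ((n%:R `^ q^-1)%:E *
    (1 + n%:R^-1 * \sum_(i < n) `|Y i x| `^ r)%R%:E))).
  apply: ge0_le_integral => //.
  - by move=> x _; rewrite lee_fin lqnorm_ge0.
  - apply/measurable_EFinP; apply: measurableT_comp (@measurable_lqnorm n q) _.
    apply/measurable_fun_tnthP => i; rewrite (_ : _ \o _ = Y i)//.
    by apply/funext => x /=; rewrite tnth_mktuple.
  - by apply: measurable_funeM; exact/measurable_EFinP.
  - move=> x _; rewrite -EFinM lee_fin.
    apply: le_trans (lqnorm_le _ n0 q0 qr r1) _.
    by under eq_bigr do rewrite tnth_mktuple.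
rewrite ge0_integralZl//; last 2 first.
- exact/measurable_EFinP.
- by move=> x _; rewrite lee_fin addr_ge0.
rewrite mulrC EFinM lee_wpmul2l ?lee_fin ?powR_ge0//.
under eq_integral do rewrite EFinD EFinM -sumEFin.
have mY' i : measurable_fun setT (fun x => (`|Y i x| `^ r)%:E).
  exact/measurable_EFinP.
have mS : measurable_fun setT (fun x => \sum_(i < n) (`|Y i x| `^ r)%:E).
  exact: emeasurable_sum.
have S0 x : 0 <= \sum_(i < n) (`|Y i x| `^ r)%:E.
  by rewrite sume_ge0// => i _; rewrite lee_fin powR_ge0.
rewrite ge0_integralD//; last 2 first.
- by move=> x _; rewrite mule_ge0// lee_fin.
- exact: measurable_funeM.
rewrite integral_cst// mul1e EFinD leeD//; first exact: probability_le1.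
rewrite ge0_integralZl// ge0_integral_sum//.
apply: (@le_trans _ _ ((n%:R^-1)%:E * \sum_(i < n) C%:E)).
  rewrite lee_wpmul2l ?lee_fin//; apply: lee_sum => i _.
  by apply: CP => // u u0; exact: PY.
rewrite sumEFin -EFinM lee_fin sumr_const card_ord -[(C *+ n)%R]mulr_natl.
rewrite mulrA mulVf ?mul1r//.
by rewrite pnatr_eq0 -lt0n.
Qed.

End lqnorm_bounds.

(** * Lebesgue measure under dilations and diagonal linear maps *)

Section scaling.
Context {R : realType}.
Local Notation mu := (@lebesgue_measure R).
Local Open Scope ereal_scope.

Lemma measurable_scale (a : R) :
  measurable_fun setT ((fun t => a * t)%R : measurableTypeR R -> measurableTypeR R).
Proof. exact: measurable_funM. Qed.

(** The measure [B |-> a * mu (f^-1 B)] agrees with [mu] on half-open intervals, hence everywhere by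
    uniqueness of Lebesgue measure. *)
Lemma lebesgue_measure_scale (a : R) (a0 : (0 < a)%R) A : measurable A ->
  mu ((fun t => a * t)%R @^-1` A) = a^-1%:E * mu A.
Proof.
move=> mA.
pose f := (fun t => a * t)%R : measurableTypeR R -> measurableTypeR R.
have [nu nuE] : exists nu : {measure set (measurableTypeR R) -> \bar R},
    forall B, nu B = a%:E * mu (f @^-1` B).
  unshelve eexists (mscale (NngNum (ltW a0)) (pushforward mu f)) => //.
  exact: measurable_scale.
suff -> : mu A = nu A by rewrite nuE muleA -EFinM mulVf ?mul1e// gt_eqF.
apply: lebesgue_measure_unique => // _ [[x y]] _ <-.
rewrite nuE (_  : f @^-1` _ = `](x / a)%R, (y / a)%R]%classic).
  rewrite !lebesgue_measure_itv/= !lte_fin ltr_pM2r ?invr_gt0//.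
  case: ifPn => _; last by rewrite mule0.
  by rewrite -!EFinB -EFinM mulrBr ![(a * _)%R]mulrC !divfK ?gt_eqF.
apply/seteqP; split => t /=; rewrite !in_itv/= ler_pdivlMr// ltr_pdivrMr//.
  by rewrite ![(t * a)%R]mulrC.
by rewrite ![(t * a)%R]mulrC.
Qed.

Lemma ge0_integral_scale (a : R) (a0 : (0 < a)%R) (g : R -> \bar R) :
  measurable_fun setT g -> (forall t, 0 <= g t) ->
  \int[mu]_t g (a * t)%R = a^-1%:E * \int[mu]_t g t.
Proof.
move=> mg g0; have aV : (0 <= a^-1)%R by rewrite invr_ge0 ltW.
pose f := (fun t => a * t)%R : measurableTypeR R -> measurableTypeR R.
have := @ge0_integral_mscale _ _ R mu setT measurableT (NngNum aV) g mg.
move=> /(_ (fun t _ => g0 t)) <-.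
have := @ge0_integral_pushforward _ _ _ _ R f (measurable_scale a) mu setT g
  measurableT mg (fun t _ => g0 t).
rewrite preimage_setT => <-.
apply: eq_measure_integral => [|mf A mA _]; first exact: measurable_scale.
exact: lebesgue_measure_scale.
Qed.

Definition tdiag n (a x : n.-tuple R) : n.-tuple R :=
  [tuple (tnth a i * tnth x i)%R | i < n].

Lemma measurable_tdiag n (a : n.-tuple R) : measurable_fun setT (tdiag a).
Proof.
apply/measurable_fun_tnthP => i.
rewrite (_ : _ \o _ = fun x => (tnth a i * tnth x i)%R); last first.
  by apply/funext => x /=; rewrite tnth_mktuple.
by apply: measurable_funM => //; exact: measurable_tnth.
Qed.

(** By induction on [n]: the measure is the integral over the first coordinate of the measures of
    the slices. The induction hypothesis scales each slice, and one-dimensional scaling handles the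
    outer integral. *)
Lemma lebesgue_tuple_diag n (a : n.-tuple R) (E : set (n.-tuple R)) :
  (forall i, 0 < tnth a i)%R -> measurable E ->
  lebesgue_tuple R n (tdiag a @^-1` E) =
  (\prod_(i < n) tnth a i)^-1%:E * lebesgue_tuple R n E.
Proof.
elim: n a E => [|n ih] a E a0 mE.
  rewrite big_ord0 invr1 mul1e (_ : tdiag a = id)//.
  by apply/funext => x; rewrite [x]tuple0 [LHS]tuple0.
rewrite /= /lebesgue_tuple_step /pushforward /product_measure1.
set cons1 := (fun z : _ * _ => _); set F := cons1 @^-1` E.
have mF : measurable F.
  rewrite -[F]setTI; suff : measurable_fun setT cons1 by apply.
  by apply: measurable_cons; [exact: measurable_fst|exact: measurable_snd].
pose a' := [tuple tnth a (lift ord0 i) | i < n].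
have a'0 i : (0 < tnth a' i)%R by rewrite tnth_mktuple.
have c0 : (0 <= (\prod_(i < n) tnth a' i)^-1)%R.
  by rewrite invr_ge0 prodr_ge0// => i _; rewrite ltW.
pose g t := (\prod_(i < n) tnth a' i)^-1%:E * lebesgue_tuple R n (xsection F t).
have mxF : measurable_fun setT (lebesgue_tuple R n \o xsection F).
  exact: measurable_fun_xsection.
transitivity (\int[mu]_t g (tnth a ord0 * t)%R).
  (* The slice at [t] of the preimage is the preimage under [tdiag a'] of the slice of [F] at
     [tnth a ord0 * t]. *)
  apply: eq_integral => t _; rewrite /g -(ih a')//; last exact: measurable_xsection.
  rewrite /comp; congr (lebesgue_tuple R n _).
  rewrite !xsectionE; apply/funext => y; congr E; apply: eq_from_tnth => i /=.
  rewrite tnth_mktuple; case: (unliftP ord0 i) => [k|] -> //.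
  by rewrite !tnthS !tnth_mktuple.
transitivity ((tnth a ord0)^-1%:E * \int[mu]_t g t).
  apply: (ge0_integral_scale (a0 ord0)); first exact: measurable_funeM.
  by move=> t; rewrite mule_ge0// lee_fin.
rewrite ge0_integralZl// muleA -EFinM -invfM big_ord_recl.
by under eq_bigr do rewrite tnth_mktuple.
Qed.

End scaling.

(** * Tail bound for one coordinate under the cone measure *)

Section cone_tail.
Context {R : realType} (p : R) (p0 : 0 < p).

Lemma measurable_sum_powR n : measurable_fun setT
  (fun x : n.-tuple R => \sum_(i < n) tnth x i `^ p).
Proof.
apply: measurable_sum => i.
apply: (@measurableT_comp _ _ _ _ _ _ (@powR R ^~ p)) => //.
exact: measurable_tnth.
Qed.

Lemma measurable_nneg_tuple n :
  measurable [set x : n.-tuple R | forall i, 0 <= tnth x i].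
Proof.
rewrite (_ : mkset _ =
    \bigcap_(i in [set: 'I_n]) ((@tnth n R ^~ i) @^-1` `[0, +oo[)).
  apply: fin_bigcap_measurable => // i _.
  by rewrite -[X in measurable X]setTI; exact: measurable_tnth.
apply/seteqP; split=> x /= xa i; first by move=> _; rewrite /= in_itv/= xa.
by have := xa i I; rewrite /= in_itv/= andbT.
Qed.

Lemma measurable_lp_simplex n : measurable (@lp_simplex R n p).
Proof.
apply: measurableI; first exact: measurable_nneg_tuple.
rewrite -[X in measurable X]setTI.
exact: (@measurable_sum_powR n measurableT [set 1]).
Qed.

Lemma ler_powR2r (e a b : R) : 0 < e -> 0 <= a -> 0 <= b ->
  (a `^ e <= b `^ e) = (a <= b).
Proof.
move=> e0 a0 b0; apply/idP/idP => [|ab]; last first.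
  by apply: ge0_ler_powR => //; rewrite ltW.
by apply: contraTT; rewrite -!ltNge => ba; exact: gt0_ltr_powR.
Qed.

Lemma powR_le1 (e a : R) : 0 < e -> 0 <= a -> (a `^ e <= 1) = (a <= 1).
Proof. by move=> e0 a0; rewrite -(ler_powR2r e0 a0 ler01) powR1. Qed.

(** A nonzero point of the right-hand side is rescaled to the simplex without leaving [H]. The
    origin lies in the cone because the trace of [H] on the simplex is nonempty. *)
Lemma cone_homogeneous_lp_simplex n (H : set (n.-tuple R)) :
  (forall (t : R) x, 0 <= t -> H x -> H (tscale t x)) ->
  H `&` lp_simplex p !=set0 ->
  cone `[0, 1] (H `&` lp_simplex p) =
  [set x | [/\ forall i, 0 <= tnth x i, \sum_(i < n) tnth x i `^ p <= 1 & H x]].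
Proof.
move=> HZ [y [Hy [y0 Sy]]].
have SZ (t : R) (x : n.-tuple R) : 0 <= t -> (forall i, 0 <= tnth x i) ->
    \sum_(i < n) tnth (tscale t x) i `^ p = t `^ p * \sum_(i < n) tnth x i `^ p.
  move=> t0 x0; rewrite mulr_sumr; apply: eq_bigr => i _.
  by rewrite tnth_mktuple powRM.
apply/seteqP; split => [_ [t + [x [Hx [x0 Sx]]] <-]|x [x0 Sx Hx]].
  rewrite /= in_itv/= => /andP[t0 t1]; split; last exact: HZ.
    by move=> i; rewrite tnth_mktuple mulr_ge0.
  by rewrite SZ// Sx mulr1 powR_le1.
set S := \sum_(i < n) _ in Sx.
have S0 : 0 <= S by rewrite sumr_ge0// => i _; exact: powR_ge0.
have [SE|Sn] := eqVneq S 0.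
  exists 0; first by rewrite /= in_itv/= lexx ler01.
  exists y => //; apply: eq_from_tnth => i; rewrite tnth_mktuple mul0r.
  have := psumr_eq0P (fun i _ => powR_ge0 (tnth x i) p) SE => /(_ i isT).
  by move=> /powR_eq0_eq0.
have Sgt : 0 < S by rewrite lt_neqAle eq_sym Sn.
exists (S `^ p^-1).
  by rewrite /= in_itv/= powR_ge0/= powR_le1 ?invr_gt0.
exists (tscale (S `^ p^-1)^-1 x); last first.
  apply: eq_from_tnth => i; rewrite !tnth_mktuple mulrA mulfV ?mul1r//.
  by rewrite gt_eqF// powR_gt0.
split; first by apply: HZ => //; rewrite invr_ge0 powR_ge0.
split=> [i|]; first by rewrite tnth_mktuple mulr_ge0// invr_ge0 powR_ge0.
rewrite SZ ?invr_ge0 ?powR_ge0// -/S -powRN -powRrM mulNr mulVf ?gt_eqF//.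
by rewrite powR_inv1// mulVf.
Qed.

Lemma cone_measure_tail n (n0 : (0 < n)%N) (i : 'I_n) (u : R) : 0 < u ->
  (cone_measure p0 n0 [set x | u <= `|n%:R `^ p^-1 * tnth x i|]%R <=
   (2 `^ p^-1 * expR (- ((2 * p)^-1 * u `^ p)))%:E)%E.
Proof.
move=> u0; set A := [set x | _]; have nR : 0 < n%:R :> R by rewrite ltr0n.
have [A0|/set0P A0] := eqVneq (A `&` @lp_simplex R n p) set0.
  rewrite /cone_measure A0 (_ : cone _ set0 = set0).
    by rewrite measure0 mul0e lee_fin mulr_ge0 ?powR_ge0 ?expR_ge0.
  by apply/seteqP; split => // x [t _ []].
pose w := u `^ p / n%:R.
have w0 : 0 < w by rewrite divr_gt0 ?powR_gt0.
(* [H] is the homogeneous form of [A]: on the simplex the sum equals 1, and both conditions become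
   [u ^ p <= n * x_i ^ p]. *)
pose H : set (n.-tuple R) :=
  [set x | w * \sum_(j < n) `|tnth x j| `^ p <= `|tnth x i| `^ p].
have normS (x : n.-tuple R) : (forall j, 0 <= tnth x j) ->
    \sum_(j < n) `|tnth x j| `^ p = \sum_(j < n) tnth x j `^ p.
  by move=> x0; apply: eq_bigr => j _; rewrite ger0_norm.
have AH : A `&` lp_simplex p = H `&` lp_simplex p.
  suff AHx x : lp_simplex p x -> A x = H x.
    by apply/seteqP; split => x [+ Dx] => hx; split => //; move: hx; rewrite AHx.
  move=> [x0 Sx]; rewrite /A /H/= normS// Sx mulr1 ler_pdivrMr// [_ * n%:R]mulrC.
  rewrite (_ : n%:R * _ = `|n%:R `^ p^-1 * tnth x i| `^ p).
    by rewrite ler_powR2r// ltW.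
  rewrite normrM powRM// (ger0_norm (powR_ge0 _ _)) -powRrM mulVf ?gt_eqF//.
  by rewrite powRr1// ltW.
have HZ (t : R) x : 0 <= t -> H x -> H (tscale t x).
  move=> t0; rewrite /H/= => Hx.
  under eq_bigr do rewrite tnth_mktuple normrM powRM//.
  by rewrite tnth_mktuple normrM powRM// -mulr_sumr mulrCA ler_wpM2l ?powR_ge0.
have [y [Hy Dy]] : H `&` lp_simplex p !=set0 by rewrite -AH.
(* A point of the simplex in [H] has [w <= x_i ^ p <= 1], which makes [b = 1 - w / 2] positive. *)
have w1 : w <= 1.
  move: Hy Dy => + [y0 Sy]; rewrite /H/= normS// Sy mulr1 => /le_trans; apply.
  rewrite -Sy (bigD1 i)//= ger0_norm// lerDl sumr_ge0// => j _.
  exact: powR_ge0.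
(* [tdiag a] maps the cone over A into the unit ball and has determinant
   [(t ^+ n * s)^-1]. *)
pose b := 1 - w / 2.
have b0 : 0 < b by rewrite /b; lra.
pose s : R := 2 `^ p^-1.
have s0 : 0 < s by rewrite powR_gt0.
pose t := b `^ p^-1.
have t0 : 0 < t by rewrite powR_gt0.
pose a := [tuple t^-1 * (if j == i then s^-1 else 1) | j < n].
have a0 j : 0 < tnth a j.
  by rewrite tnth_mktuple; case: ifP; rewrite ?mulr1 ?mulr_gt0 ?invr_gt0.
have prodaE : \prod_(j < n) tnth a j = (t ^+ n * s)^-1.
  under eq_bigr do rewrite tnth_mktuple.
  rewrite big_split/= prodr_const card_ord -big_mkcond/= big_pred1_eq.
  by rewrite exprVn invfM.
have aE j (x : n.-tuple R) : (forall j, 0 <= tnth x j) -> (tnth a j * tnth x j) `^ p =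
    b^-1 * (tnth x j `^ p - if j == i then tnth x i `^ p / 2 else 0).
  move=> x0; have inv_powR c : 0 < c -> (c `^ p^-1)^-1 `^ p = c^-1.
    by move=> c0; rewrite -powRN -powRrM mulNr mulVf ?gt_eqF// powR_inv1// ltW.
  rewrite tnth_mktuple; set c := if _ then s^-1 else 1.
  have c0 : 0 <= c by rewrite /c; case: ifP => _ //; rewrite invr_ge0 ltW.
  have tV0 : 0 <= t^-1 by rewrite invr_ge0 ltW.
  rewrite powRM ?mulr_ge0// powRM// inv_powR// -mulrA /c; congr (_ * _).
  case: eqP => [->|_]; last by rewrite powR1 mul1r subr0.
  by rewrite inv_powR//; lra.
have coneH := cone_homogeneous_lp_simplex HZ (ex_intro _ y (conj Hy Dy)).
have coneT : cone `[0, 1] (lp_simplex p) =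
    [set x : n.-tuple R | (forall j, 0 <= tnth x j) /\ \sum_(j < n) tnth x j `^ p <= 1].
  rewrite -[lp_simplex p]setTI cone_homogeneous_lp_simplex//; last by exists y.
  by apply/seteqP; split => x [].
have mT : measurable (cone `[0, 1] (@lp_simplex R n p)).
  rewrite coneT; apply: measurableI; first exact: measurable_nneg_tuple.
  rewrite -[X in measurable X]setTI; apply: measurable_fun_le => //.
  exact: measurable_sum_powR.
have mnorm j : measurable_fun setT (fun x : n.-tuple R => `|tnth x j| `^ p).
  apply: (@measurableT_comp _ _ _ _ _ _ (@powR R ^~ p)) => //.
  by apply: measurableT_comp => //; exact: measurable_tnth.
have mH : measurable (cone `[0, 1] (H `&` lp_simplex p)).
  rewrite coneH (_ : mkset _ = cone `[0, 1] (@lp_simplex R n p) `&` H).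
    apply: measurableI => //; rewrite -[H]setTI; apply: measurable_fun_le => //.
    by apply: measurable_funM => //; exact: measurable_sum.
  by rewrite coneT; apply/seteqP; split => x => [[]|[[]]].
(* With [S] the sum of the [x_j ^ p], the image under [tdiag a] has sum [(S - x_i ^ p / 2) / b]. On
   [H] the numerator is at most [(1 - w / 2) * S <= b]. *)
have subHT : cone `[0, 1] (H `&` lp_simplex p) `<=`
    tdiag a @^-1` cone `[0, 1] (lp_simplex p).
  rewrite coneH coneT => x [x0 Sx Hx]; split => [j|].
    by rewrite tnth_mktuple mulr_ge0// ltW.
  under eq_bigr do rewrite tnth_mktuple aE//.
  rewrite -mulr_sumr big_split/= sumrN -big_mkcond/= big_pred1_eq.
  rewrite mulrC ler_pdivrMr// mul1r.
  move: Hx; rewrite /H/= normS// ger0_norm// /b; set S := \sum_(j < n) _.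
  move=> Hx; have : (1 - w / 2) * S <= 1 - w / 2.
    by rewrite -[leRHS]mulr1 ler_wpM2l// ltW.
  lra.
set v := lebesgue_tuple R n (cone `[0, 1] (lp_simplex p)).
have v0 : (0 < v)%E := lebesgue_cone_lp_simplex_gt0 p0 n0.
pose c := fine v; have cE : v = c%:E.
  by rewrite fineK// gt0_fin_numE//; exact: lebesgue_cone_lp_simplex_lty.
have c0 : 0 < c by rewrite -lte_fin -cE.
rewrite /cone_measure AH -/v cE inver gt_eqF//.
apply: (@le_trans _ _ ((t ^+ n * s)%:E * c%:E * c^-1%:E)%E).
  rewrite lee_wpmul2r ?lee_fin ?invr_ge0 ?(ltW c0)//.
  apply: (@le_trans _ _ (lebesgue_tuple R n (tdiag a @^-1` cone `[0, 1] (lp_simplex p)))).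
    apply: le_measure; rewrite ?inE//.
    by rewrite -[X in measurable X]setTI; exact: measurable_tdiag.
  by rewrite lebesgue_tuple_diag// prodaE invrK -/v cE.
rewrite -!EFinM mulfK ?gt_eqF// lee_fin mulrC ler_wpM2l ?powR_ge0//.
(* Since [n * w = u ^ p], this yields [t ^ n = b ^ (n / p) <= exp (- u ^ p / (2 p))]; the factor
   [s = 2 ^ (1/p)] is the constant in front. *)
have bw : b <= expR (- (w / 2)) by rewrite /b expR_ge1Dx.
have tE : t <= expR (- (w / 2) * p^-1).
  rewrite expRM; apply: ge0_ler_powR => //; rewrite ?nnegrE ?expR_ge0// ?ltW//.
  by rewrite invr_gt0.
have := lerXn2r n (_ : t \in Num.nneg) (_ : _ \in Num.nneg) tE.
rewrite !nnegrE expR_ge0 ltW// => /(_ isT isT) /le_trans; apply.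
rewrite -expRM_natl ler_expR le_eqVlt; apply/orP; left; apply/eqP.
by rewrite /w; field; rewrite ?gt_eqF.
Qed.

End cone_tail.

(** * Two-sided bounds for the mean norm under the cone measure *)

Section best_approx_of_cone_measure.
Context {R : realType}.

Lemma best_approx0 n q (x : n.-tuple R) : best_approx q 0 x = lqnorm q x.
Proof.
rewrite /best_approx (_ : [set _ | _ in _] = [set lqnorm q x]) ?inf1//.
have subx0 : tsub x [tuple 0 | i < n] = x.
  by apply: eq_from_tnth => i; rewrite !tnth_mktuple subr0.
apply/seteqP; split => [_ [y /= y0 <-]|_ ->].
  suff -> : y = [tuple 0 | i < n] by rewrite subx0.
  apply: eq_from_tnth => i; rewrite tnth_mktuple.
  move: y0; rewrite /sparse/= leqn0 => /eqP/card0_eq/(_ i); rewrite inE.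
  by move=> /negbT; rewrite negbK => /eqP.
exists [tuple 0 | i < n]; last by rewrite subx0.
rewrite /sparse/= leqn0; apply/eqP/eq_card0 => i.
by rewrite inE tnth_mktuple eqxx.
Qed.

Lemma cone_measure_lp_simplex n (p : R) (p0 : 0 < p) (n0 : (0 < n)%N) :
  cone_measure p0 n0 (lp_simplex p) = 1%E.
Proof.
transitivity (cone_measure p0 n0 setT); last exact: probability_setT.
by rewrite /cone_measure setIid setTI.
Qed.

(** On the simplex the mean of the [x_i ^ p] is [1 / n], so the power mean of order [p] is exactly
    [n ^ (- 1/p)]. *)
Lemma lp_simplex_lqnorm_ge n (p q : R) (x : n.-tuple R) : (0 < n)%N -> 0 < p -> p <= q ->
  lp_simplex p x -> n%:R `^ (q^-1 - p^-1) <= lqnorm q x.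
Proof.
move=> n0 p0 pq [x0 Sx]; have q0 := lt_le_trans p0 pq.
have nR : 0 < n%:R :> R by rewrite ltr0n.
rewrite lqnormE// powRD ?(gt_eqF nR) ?implybT// ler_wpM2l ?powR_ge0//.
apply: le_trans (power_mean p0 pq _) => //.
under eq_bigr do rewrite ger0_norm//.
by rewrite Sx mulr1 -[n%:R^-1]powR_inv1// -powRrM mulN1r.
Qed.

Lemma lqnormZ n (q t : R) (x : n.-tuple R) : 0 < q -> 0 <= t ->
  lqnorm q [tuple t * tnth x i | i < n] = t * lqnorm q x.
Proof.
move=> q0 t0; rewrite /lqnorm.
under eq_bigr do rewrite tnth_mktuple normrM ger0_norm// powRM//.
rewrite -mulr_sumr powRM ?powR_ge0 ?sumr_ge0//.
by rewrite -powRrM mulfV ?gt_eqF// powRr1.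
Qed.

Lemma cone_measure_lqnorm_ge n (p q : R) (p0 : 0 < p) (n0 : (0 < n)%N) : p <= q ->
  ((n%:R `^ (q^-1 - p^-1))%:E <=
    \int[cone_measure p0 n0]_(x in lp_simplex p) (lqnorm q x)%:E)%E.
Proof.
move=> pq; have mS := @measurable_lp_simplex R p n.
rewrite -[leLHS]mule1 -(cone_measure_lp_simplex p0 n0) -integral_cst//.
apply: ge0_le_integral => //.
- by move=> x _; rewrite lee_fin powR_ge0.
- by apply/measurable_EFinP/measurable_funTS; exact: measurable_lqnorm.
- by move=> x Sx; rewrite lee_fin; exact: lp_simplex_lqnorm_ge.
Qed.

Lemma cone_measure_lqnorm_le (p q : R) (p0 : 0 < p) : 0 < q ->
  exists2 C : R, 0 < C & forall n (n0 : (0 < n)%N),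
    (\int[cone_measure p0 n0]_(x in lp_simplex p) (lqnorm q x)%:E <=
      (C * n%:R `^ (q^-1 - p^-1))%:E)%E.
Proof.
move=> q0; have a0 : 0 < (2 * p)^-1 by rewrite invr_gt0 mulr_gt0.
have [C C0 CP] := lqnorm_tail_expectation p0 q0 (powR_ge0 2 p^-1) a0.
exists C => // n n0; have nR : 0 < n%:R :> R by rewrite ltr0n.
have mS := @measurable_lp_simplex R p n.
have mlq : measurable_fun setT (fun x : n.-tuple R => (lqnorm q x)%:E).
  by apply/measurable_EFinP; exact: measurable_lqnorm.
apply: (@le_trans _ _ (\int[cone_measure p0 n0]_x (lqnorm q x)%:E)%E).
  apply: ge0_subset_integral => //.
  by move=> x _; rewrite lee_fin lqnorm_ge0.
have -> : C * n%:R `^ (q^-1 - p^-1) = n%:R `^ (- p^-1) * (C * n%:R `^ q^-1).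
  by rewrite powRD ?(gt_eqF nR) ?implybT//; ring.
(* The dilation by [n ^ (1/p)] gives the coordinates tails independent of [n]; homogeneity of the
   norm returns the factor [n ^ (- 1/p)]. *)
pose f (x : n.-tuple R) := lqnorm q [tuple n%:R `^ p^-1 * tnth x i | i < n].
have mf : measurable_fun setT (EFin \o f).
  apply/measurable_EFinP; rewrite /f.
  under eq_fun do rewrite lqnormZ ?powR_ge0//.
  by apply: measurable_funM => //; exact: measurable_lqnorm.
have f0 x : setT x -> (0 <= (EFin \o f) x)%E by move=> _; rewrite lee_fin lqnorm_ge0.
have k0 : (0 <= (n%:R `^ (- p^-1))%:E :> \bar R)%E by rewrite lee_fin powR_ge0.
have := ge0_integralZl (cone_measure p0 n0) measurableT mf f0 k0.
rewrite [X in X = _ -> _](_ : _ = \int[cone_measure p0 n0]_x (lqnorm q x)%:E)%E.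
  move=> ->; rewrite EFinM; apply: lee_wpmul2l => //.
  apply: CP => // [i|i u u0]; last exact: cone_measure_tail.
  by apply: measurable_funM => //; exact: measurable_tnth.
apply: eq_integral => x _; rewrite /= -EFinM /f lqnormZ ?powR_ge0// powRN mulKf//.
by rewrite gt_eqF// powR_gt0.
Qed.

End best_approx_of_cone_measure.

(** * Lower bound for the mean norm when each coordinate is often large *)

Section lqnorm_expectation_lower_bound.
Context {R : realType}.

(** This minorant of the norm is affine in the proportion of coordinates of size at least [a], so
    its expectation depends only on the marginal laws. *)
Lemma lqnorm_ge_count n (q a : R) (y : n.-tuple R) : (0 < n)%N -> 0 < q -> 0 < a ->
  n%:R `^ q^-1 * (a * 4^-1 `^ q^-1 * (n%:R^-1 * \sum_(i < n) (a <= `|tnth y i|)%R%:R)) <=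
  lqnorm q y + n%:R `^ q^-1 * (a * 4^-1 `^ q^-1 / 4).
Proof.
move=> n0 q0 a0; set b := a * 4^-1 `^ q^-1; have nR : 0 < n%:R :> R by rewrite ltr0n.
have b0 : 0 < b by rewrite mulr_gt0 ?powR_gt0 ?invr_gt0.
rewrite lqnormE// -mulrDr ler_wpM2l ?powR_ge0//.
(* The claim is trivial unless at least a quarter of the coordinates exceed a. *)
set N := n%:R^-1 * _; set g := _ `^ _.
have g0 : 0 <= g by exact: powR_ge0.
have [N4|N4] := ltP N 4^-1; first by rewrite ler_wpDl// ler_wpM2l ?ltW.
have N1 : N <= 1.
  rewrite /N mulrC ler_pdivrMr// mul1r.
  rewrite (_ : n%:R = \sum_(i < n) (1 : R)); last by rewrite sumr_const card_ord.
  by apply: ler_sum => i _; rewrite (ler_nat _ _ 1) leq_b1.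
rewrite ler_wpDr ?divr_ge0 ?(ltW b0)//.
apply: (@le_trans _ _ b); first by rewrite ger_pMr.
rewrite /b /g -[a in leLHS](powRr1 (ltW a0)) -{1}(mulfV (_ : q != 0)) ?gt_eqF//.
rewrite powRrM -powRM ?powR_ge0 ?invr_ge0//.
apply: ge0_ler_powR; rewrite ?nnegrE ?invr_ge0 ?(ltW q0)//.
- by rewrite mulr_ge0 ?powR_ge0 ?invr_ge0.
- by rewrite mulr_ge0 ?invr_ge0 ?sumr_ge0// => i _; exact: powR_ge0.
apply: (@le_trans _ _ (a `^ q * N)); first by rewrite ler_wpM2l ?powR_ge0.
rewrite /N mulrCA ler_wpM2l ?invr_ge0// mulr_sumr; apply: ler_sum => i _.
case: (leP a) => ai; last by rewrite mulr0n mulr0 powR_ge0.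
by rewrite mulr1n mulr1 ge0_ler_powR ?nnegrE// ltW.
Qed.

(** The expected proportion of large coordinates is at least 1/2. With [b = a * 4 ^ (- 1/q)], the
    affine minorant then leaves [b / 2 - b / 4 = b / 4]. *)
Lemma lqnorm_expectation_ge n (q a : R) d (T : measurableType d)
    (P : probability T R) (Y : 'I_n -> T -> R) :
  (0 < n)%N -> 0 < q -> 0 < a ->
  (forall i, measurable_fun setT (Y i)) ->
  (forall i, (2^-1%:E <= P [set x | a <= `|Y i x|]%R)%E) ->
  ((a * 4^-1 `^ q^-1 / 4 * n%:R `^ q^-1)%:E <=
    \int[P]_x (lqnorm q [tuple Y i x | i < n])%:E)%E.
Proof.
move=> n0 q0 a0 mY PY; have nR : 0 < n%:R :> R by rewrite ltr0n.
set b := a * _; have b0 : 0 < b by rewrite mulr_gt0 ?powR_gt0 ?invr_gt0.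
set k := n%:R `^ q^-1; have k0 : 0 < k by rewrite powR_gt0.
pose g x := lqnorm q [tuple Y i x | i < n].
have mg : measurable_fun setT g.
  apply: measurableT_comp (@measurable_lqnorm R n q) _.
  apply/measurable_fun_tnthP => i; rewrite (_ : _ \o _ = Y i)//.
  by apply/funext => x /=; rewrite tnth_mktuple.
pose A i := [set x | a <= `|Y i x|].
have mA i : measurable (A i).
  rewrite -[A i]setTI; apply: measurable_fun_le => //.
  exact: measurableT_comp.
pose h x : \bar R := ((k * b / n%:R)%:E * \sum_(i < n) (\1_(A i) x)%:E)%E.
have kb0 : 0 <= k * b / n%:R by rewrite !mulr_ge0 ?invr_ge0// ltW.
have mI i : measurable_fun setT (fun x => (\1_(A i) x)%:E : \bar R).
  exact/measurable_EFinP/measurable_indic.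
have mS : measurable_fun setT (fun x => \sum_(i < n) (\1_(A i) x)%:E : \bar R)%E.
  exact: emeasurable_sum.
have S0 x : (0 <= \sum_(i < n) (\1_(A i) x)%:E :> \bar R)%E.
  by rewrite sume_ge0// => i _; rewrite lee_fin.
have hg : (\int[P]_x h x <= \int[P]_x ((g x)%:E + (k * (b / 4))%:E))%E.
  apply: ge0_le_integral => //.
  - by move=> x _; rewrite mule_ge0.
  - exact: measurable_funeM.
  - by apply: emeasurable_funD => //; exact/measurable_EFinP.
  move=> x _; rewrite /h sumEFin -EFinM -EFinD lee_fin.
  apply: le_trans (lqnorm_ge_count [tuple Y i x | i < n] n0 q0 a0).
  rewrite (_ : k * b / n%:R * _ =
    k * (b * (n%:R^-1 * \sum_(i < n) \1_(A i) x))); last by ring.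
  rewrite -/b -/k ler_wpM2l ?(ltW k0)// ler_wpM2l ?(ltW b0)//.
  rewrite ler_wpM2l ?invr_ge0//; apply: ler_sum => i _.
  rewrite tnth_mktuple indicE (_ : (x \in A i) = (a <= `|Y i x|))//.
  by apply/idP/idP => [/set_mem//|?]; exact/mem_set.
have hE : ((k * (b / 2))%:E <= \int[P]_x h x)%E.
  rewrite /h ge0_integralZl// ge0_integral_sum//.
  apply: (@le_trans _ _ ((k * b / n%:R)%:E * \sum_(i < n) 2^-1%:E)%E).
    rewrite sumEFin -EFinM lee_fin sumr_const card_ord -[2^-1 *+ n]mulr_natl.
    by rewrite !mulrA divfK ?gt_eqF.
  rewrite lee_wpmul2l ?lee_fin//; apply: lee_sum => i _.
  by rewrite integral_indic// setIT; exact: PY.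
have := le_trans hE hg.
rewrite ge0_integralD//; last 3 first.
- by move=> x _; rewrite lee_fin lqnorm_ge0.
- exact/measurable_EFinP.
- by move=> x _; rewrite lee_fin mulr_ge0 ?divr_ge0 ?ltW.
rewrite integral_cst// [X in (_ * X)%E](_ : _ = 1%E); last exact: probability_setT.
rewrite mule1 -leeBlDr// -EFinB; apply: le_trans; rewrite lee_fin.
lra.
Qed.

End lqnorm_expectation_lower_bound.

(** * Elementary bounds on the generalized normal density *)

Section gen_normal.
Context {R : realType} (p : R) (p0 : 0 < p).
Local Notation mu := (@lebesgue_measure R).
Local Notation f := (gen_normal_pdf p).

Lemma Gamma_ge0 (x : R) : 0 <= Gamma x.
Proof. by apply: Rintegral_ge0 => t _; rewrite mulr_ge0 ?powR_ge0 ?expR_ge0. Qed.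

Lemma gen_normal_pdf_ge0 t : 0 <= f t.
Proof.
rewrite /gen_normal_pdf; case: ifP => // _.
by rewrite mulr_ge0 ?expR_ge0// invr_ge0 Gamma_ge0.
Qed.

Lemma gen_normal_pdf_le t : f t <= (Gamma (p^-1 + 1))^-1.
Proof.
have G0 : 0 <= (Gamma (p^-1 + 1) : R)^-1 by rewrite invr_ge0 Gamma_ge0.
rewrite /gen_normal_pdf; case: ifP => // _.
by rewrite ler_piMr// -expR0 ler_expR oppr_le0 powR_ge0.
Qed.

Lemma measurable_gen_normal_pdf : measurable_fun setT f.
Proof.
apply: measurable_fun_ifT => //.
  by apply: measurable_fun_ler.
apply: measurable_funM => //; apply: measurableT_comp => //.
by apply: measurableT_comp => //; exact: (@measurable_powR R p).
Qed.

End gen_normal.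

(** * Tails and small values of a variable with this density *)

Section has_density_gen_normal.
Context {R : realType} (p : R) (p0 : 0 < p).
Context d (Omega : measurableType d) (P : probability Omega R).
Variable X : {RV P >-> R}.
Hypothesis Xf : has_density X (gen_normal_pdf p).
Local Notation mu := (@lebesgue_measure R).
Local Notation f := (gen_normal_pdf p).
Local Open Scope ereal_scope.

(** The total mass is read off from the law of [X], which is a probability measure, instead of from
    the Gamma integral. *)
Lemma integral_gen_normal_pdf : \int[mu]_t (f t)%:E = 1.
Proof.
transitivity (distribution P X setT); first by rewrite Xf.
exact: probability_setT.
Qed.

Lemma gen_normal_tail (u : R) : (0 < u)%R ->
  P [set x | u <= `|X x|]%R <= (2 `^ p^-1 * expR (- (2^-1 * u `^ p)))%:E.
Proof.
move=> u0; pose D : set R := [set t | u <= `|t|]%R.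
have mD : measurable D.
  rewrite -[D]setTI; apply: measurable_fun_le => //.
rewrite (_ : P _ = distribution P X D)// Xf//.
pose s : R := (2^-1 `^ p^-1)%R; have s0 : (0 < s)%R by rewrite powR_gt0 ?invr_gt0.
pose E : R := expR (- (2^-1 * u `^ p)); have E0 : (0 <= E)%R by exact: expR_ge0.
have mf : measurable_fun setT (fun t => (f t)%:E).
  by apply/measurable_EFinP; exact: measurable_gen_normal_pdf.
have mfs : measurable_fun setT (fun t => (f (s * t))%:E).
  apply/measurable_EFinP.
  apply: (measurableT_comp (measurable_gen_normal_pdf p)).
  exact: measurable_funM.
have f0 t : 0 <= (f t)%:E by rewrite lee_fin gen_normal_pdf_ge0.
(* The exponent [t ^ p] splits into two halves. One is at least [u ^ p / 2] on [D] and gives the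
   factor [E]; the other is [(s t) ^ p] because [s ^ p = 1/2]. Dilating back costs
   [s^-1 = 2 ^ (1/p)]. *)
apply: (@le_trans _ _ (\int[mu]_(t in D) (E%:E * (f (s * t))%:E))).
  apply: ge0_le_integral => //.
  - exact: measurable_funTS mf.
  - by apply: measurable_funTS; exact: measurable_funeM.
  move=> t; rewrite /D/= => ut; rewrite -EFinM lee_fin /gen_normal_pdf.
  have -> : (0 <= s * t)%R = (0 <= t)%R by rewrite pmulr_rge0.
  have [t0|_] := boolP (0 <= t)%R; last by rewrite mulr0.
  rewrite mulrCA ler_wpM2l ?invr_ge0 ?Gamma_ge0// -expRD ler_expR.
  rewrite powRM ?(ltW s0)// -powRrM mulVf ?gt_eqF// powRr1 ?invr_ge0//.
  have : (u `^ p <= t `^ p)%R.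
    by apply: ge0_ler_powR; rewrite ?nnegrE ?(ltW p0) ?(ltW u0)// -(ger0_norm t0).
  lra.
apply: (@le_trans _ _ (\int[mu]_t (E%:E * (f (s * t))%:E))).
  apply: ge0_subset_integral => //; first exact: measurable_funeM.
  by move=> t _; rewrite mule_ge0.
rewrite ge0_integralZl//.
rewrite (_ : \int[mu]_t _ = s^-1%:E * \int[mu]_t (f t)%:E); last first.
  exact: (ge0_integral_scale s0 mf).
rewrite integral_gen_normal_pdf mule1 -EFinM mulrC (_ : s^-1 = 2 `^ p^-1)%R//.
by rewrite /s -powRN -[2^-1%R]powR_inv1// -powRrM mulN1r opprK.
Qed.

(** The density is at most [c], so the interval []-a, a[] has probability at most
    [2 * a * c <= 1/2]. *)
Lemma gen_normal_abs_ge (a : R) : (0 < a)%R ->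
  (4 * a * (Gamma (p^-1 + 1))^-1 <= 1)%R ->
  2^-1%:E <= P [set x | a <= `|X x|]%R.
Proof.
move=> a0; set c := (_^-1)%R => ac.
pose D : set R := `](- a)%R, a[%classic.
have mD : measurable D by exact: measurable_itv.
rewrite (_ : [set x | _] = ~` (X @^-1` D)); last first.
  apply/seteqP; split => x; rewrite /D/preimage/= in_itv/= -ltr_norml.
    by rewrite leNgt => /negP.
  by move=> /negP; rewrite -leNgt.
have mXD : measurable (X @^-1` D).
  have mX : measurable_fun setT X by exact: measurable_funPT.
  by rewrite -[_ @^-1` _]setTI; exact: mX.
rewrite probability_setC//.
suff PD : P (X @^-1` D) <= 2^-1%:E.
  rewrite leeBrDr ?fin_num_measure//.
  rewrite (le_trans (leeD2l _ PD))// -EFinD lee_fin; lra.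
rewrite (_ : P _ = distribution P X D)// Xf//.
apply: (@le_trans _ _ (\int[mu]_(t in D) (cst c%:E) t)).
  apply: ge0_le_integral => //.
  - by move=> t _; rewrite lee_fin gen_normal_pdf_ge0.
  - apply: measurable_funTS; apply/measurable_EFinP.
    exact: measurable_gen_normal_pdf.
  - by move=> t _; rewrite lee_fin gen_normal_pdf_le.
rewrite integral_cst// [X in _ * X](lebesgue_measure_itv `](- a)%R, a[)/=.
rewrite lte_fin gtrN// -EFinB -EFinM lee_fin.
by rewrite opprK; lra.
Qed.

End has_density_gen_normal.

(** * Bounds for the expected norm of omega, and the three statements together *)

Lemma expected_norm_bounds (R : realType) (p q : R) : 0 < p -> 0 < q ->
  exists C1 C2 : R, [/\ 0 < C1, 0 < C2 &
    forall (n : nat) (n0 : (0 < n)%N)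
      (d : measure_display) (Omega : measurableType d)
      (P : probability Omega R) (omega : 'I_n -> {RV P >-> R}),
      (forall i, has_density (omega i) (gen_normal_pdf p)) ->
      ((C1 * n%:R `^ q^-1)%:E <= expected_norm omega q
         <= (C2 * n%:R `^ q^-1)%:E)%E].
Proof.
move=> p0 q0; have half0 : 0 < 2^-1 :> R by rewrite invr_gt0.
have [C C0 CP] := lqnorm_tail_expectation p0 q0 (powR_ge0 2 p^-1) half0.
pose c := (Gamma (p^-1 + 1))^-1 : R.
have c0 : 0 <= c by rewrite invr_ge0 Gamma_ge0.
have c1 : 0 < 4 * (c + 1) by rewrite mulr_gt0// ltr_wpDl.
(* This threshold gives [4 * a * c <= 1]; the summand 1 keeps the denominator positive when only
   [c >= 0] is known. *)
pose a := (4 * (c + 1))^-1; have a0 : 0 < a by rewrite invr_gt0.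
exists (a * 4^-1 `^ q^-1 / 4), C; split => //.
  by rewrite !mulr_gt0 ?powR_gt0 ?invr_gt0.
move=> n n0 d Omega P omega omegaf.
have momega i : measurable_fun setT (omega i) by exact: measurable_funPT.
rewrite /expected_norm unlock; apply/andP; split; last first.
  by apply: CP => // i u u0; exact: gen_normal_tail.
apply: lqnorm_expectation_ge => // i; apply: gen_normal_abs_ge => //.
by rewrite -/c /a mulrAC ler_pdivrMr// mul1r ler_wpM2l// lerDl.
Qed.

Theorem proposition8 (R : realType) (p q : R) (p0 : 0 < p) (pq : p <= q) :
  [/\ exists C1 C2 : R, [/\ 0 < C1, 0 < C2 &
        forall (n : nat) (n2 : (2 <= n)%N)
          (d : measure_display) (Omega : measurableType d)
          (P : probability Omega R) (omega : 'I_n -> {RV P >-> R}),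
          mutually_independent omega ->
          (forall i, has_density (omega i) (gen_normal_pdf p)) ->
          ((C1 * n%:R `^ q^-1)%:E <= expected_norm omega q
             <= (C2 * n%:R `^ q^-1)%:E)%E],
      exists C1 C2 : R, [/\ 0 < C1, 0 < C2 &
        forall (n : nat) (n2 : (2 <= n)%N)
          (d : measure_display) (Omega : measurableType d)
          (P : probability Omega R) (omega : 'I_n -> {RV P >-> R}),
          mutually_independent omega ->
          (forall i, has_density (omega i) (gen_normal_pdf p)) ->
          let mu := cone_measure p0 (ltnW n2) in
          let sigma0 := average_best_approx p q 0 mu in
          [/\ (C1%:E * (expected_norm omega q / (n%:R `^ p^-1)%:E)
                 <= sigma0)%E,
              sigma0 = (\int[mu]_(x in lp_simplex p) (lqnorm q x)%:E)%E &
              (sigma0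
                 <= C2%:E * (expected_norm omega q / (n%:R `^ p^-1)%:E))%E]] &
      exists C1 C2 : R, [/\ 0 < C1, 0 < C2 &
        forall (n : nat) (n2 : (2 <= n)%N),
          ((C1 * n%:R `^ (q^-1 - p^-1))%:E
             <= average_best_approx p q 0 (cone_measure p0 (ltnW n2))
             <= (C2 * n%:R `^ (q^-1 - p^-1))%:E)%E]].
Proof.
have q0 : 0 < q by exact: lt_le_trans pq.
have [C1 [C2 [C10 C20 CP]]] := expected_norm_bounds p0 q0.
have [D D0 DP] := cone_measure_lqnorm_le p0 q0.
have sigmaE n (n0 : (0 < n)%N) : average_best_approx p q 0 (cone_measure p0 n0) =
    (\int[cone_measure p0 n0]_(x in lp_simplex p) (lqnorm q x)%:E)%E.
  by apply: eq_integral => x _; rewrite best_approx0.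
split.
- exists C1, C2; split => // n n2 d Omega P omega _ omegaf.
  by apply: CP => //; exact: ltnW.
(* The mean norm under the cone measure lies between 1 and [D] times [n ^ (1/q - 1/p)], and the
   expected norm of omega between [C1] and [C2] times [n ^ (1/q)]; the constants are the extreme
   quotients. *)
- exists C2^-1, (D / C1); split; rewrite ?invr_gt0 ?divr_gt0//.
  move=> n n2 d Omega P omega _ omegaf mu sigma0.
  have nR : 0 < n%:R :> R by rewrite ltr0n ltnW.
  have m0 : 0 < n%:R `^ p^-1 by rewrite powR_gt0.
  have km : n%:R `^ (q^-1 - p^-1) = n%:R `^ q^-1 / n%:R `^ p^-1.
    by rewrite powRD ?(gt_eqF nR) ?implybT// powRN.
  have /andP[] := CP n (ltnW n2) d Omega P omega omegaf.
  (* The two bounds exclude infinite values, so the remaining estimates are between real numbers. *)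
  case: (expected_norm omega q) => [e| |]; rewrite ?leey_eq ?leeNy_eq ?lee_fin// => Ce eC.
  rewrite inver gt_eqF// -!EFinM /sigma0 sigmaE; split => //.
    apply: le_trans (cone_measure_lqnorm_ge p0 (ltnW n2) pq).
    rewrite lee_fin km mulrA ler_wpM2r ?invr_ge0 ?(ltW m0)//.
    by rewrite mulrC ler_pdivrMr// mulrC.
  apply: le_trans (DP n (ltnW n2)) _.
  rewrite lee_fin km !mulrA ler_wpM2r ?invr_ge0 ?(ltW m0)//.
  by rewrite -mulrA ler_wpM2l ?(ltW D0)// mulrC ler_pdivlMr// mulrC.
- exists 1, D; split => // n n2; rewrite sigmaE mul1r; apply/andP; split.
    exact: cone_measure_lqnorm_ge.
  exact: DP.
Qed.
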